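(* Let $\begin{pmatrix}x\\ y\end{pmatrix},\begin{pmatrix}a\\ b\end{pmatrix}\in\mathbb{O}^2\smallsetminus\left\{\begin{pmatrix}0\\ 0\end{pmatrix}\right\}$. Then $$\Phi_{\mathbb{O}}\begin{pmatrix}x\\ y\end{pmatrix}=\Phi_{\mathbb{O}}\begin{pmatrix}a\\ b\end{pmatrix}$$ if and only if there is $c\in\mathbb{O}(1)$ such that $\begin{pmatrix}a\\ b\end{pmatrix}=\begin{pmatrix}x\\ y\end{pmatrix}\cdot c$.
   Context: $\mathbb{O}$ is the normed division algebra of octonions and $\mathbb{O}(1)=\{c\in\mathbb{O}:|c|=1\}$. The octonionic Hopf map $\Phi_{\mathbb{O}}$ from $\mathbb{O}^2$ to the $2\times 2$ traceless Hermitian octonionic matrices is $$\Phi_{\mathbb{O}}\begin{pmatrix}x\\ y\end{pmatrix}=\begin{pmatrix}\frac{|x|^2-|y|^2}{2}&x\bar{y}\\ y\bar{x}&\frac{|y|^2-|x|^2}{2}\end{pmatrix}.$$ The $\mathbb{O}(1)$-multiplication on $\mathbb{O}^2$ is defined, for $c\in\mathbb{O}(1)$, by $$\begin{pmatrix}x\\ y\end{pmatrix}\cdot c:=\begin{pmatrix}(xy^{-1})(yc)\\ yc\end{pmatrix}\ \text{if }y\neq0,\qquad \begin{pmatrix}x\\ 0\end{pmatrix}\cdot c:=\begin{pmatrix}xc\\ 0\end{pmatrix}.$$ *)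

(* Defs.v *)
From mathcomp Require Import all_boot all_order all_algebra.
From mathcomp Require Import reals.
From mathcomp Require Import ring.

Set Implicit Arguments.
Unset Strict Implicit.
Unset Printing Implicit Defensive.
Import Order.TTheory GRing.Theory Num.Theory.
Local Open Scope ring_scope.

(* Cayley-Dickson doubling: the pair (p, q) stands for p + q l, with
   (p + q l) (r + s l) = (p r - s^* q) + (s p + q r^* ) l. *)
Definition cd_conj (V : zmodType) (conj : V -> V) (x : V * V) : V * V :=
  (conj x.1, - x.2).

Definition cd_mul (V : zmodType) (conj : V -> V) (mul : V -> V -> V)
    (x y : V * V) : V * V :=
  (mul x.1 y.1 - mul (conj y.2) x.2, mul y.2 x.1 + mul x.2 (conj y.1)).

Definition cd_sqnorm (R : realType) (V : Type) (sqnorm : V -> R)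
    (x : V * V) : R :=
  sqnorm x.1 + sqnorm x.2.

(* The octonions: three doublings of the reals. Only the real vector space
   structure is inherited from the product type: its componentwise ring
   product and inverse are not those of the octonions, which are omul (infix
   *o ) and oinv below. *)
Definition octonion (R : realType) : lmodType R :=
  (((R^o * R^o) * (R^o * R^o)) * ((R^o * R^o) * (R^o * R^o)))%type.

Definition oone (R : realType) : octonion R :=
  (((1, 0), (0, 0)), ((0, 0), (0, 0))).

Definition oreal (R : realType) (r : R) : octonion R := r *: oone R.

Definition oconj (R : realType) : octonion R -> octonion R :=
  cd_conj (cd_conj (cd_conj (V := R) id)).

Definition omul (R : realType) : octonion R -> octonion R -> octonion R :=
  let conjC := cd_conj (V := R) id in
  let mulC := cd_mul (V := R) id *%R in
  let conjH := cd_conj conjC in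
  let mulH := cd_mul conjC mulC in
  cd_mul conjH mulH.

Definition osqnorm (R : realType) : octonion R -> R :=
  cd_sqnorm (cd_sqnorm (cd_sqnorm (fun r : R => r ^+ 2))).

Definition onorm (R : realType) (x : octonion R) : R := Num.sqrt (osqnorm x).

Definition oinv (R : realType) (x : octonion R) : octonion R :=
  (onorm x ^+ 2)^-1 *: oconj x.

Notation "x *o y" := (omul x y) (at level 40, left associativity) : ring_scope.

Definition unit_octonion (R : realType) : {pred octonion R} :=
  [pred c | onorm c == 1].
Arguments unit_octonion : clear implicits.

Definition ovec (R : realType) (x y : octonion R) : 'cV[octonion R]_2 :=
  \col_i (if i == 0 then x else y).

Definition omx22 (R : realType) (p q r s : octonion R) : 'M[octonion R]_2 :=
  \matrix_(i, j) (if i == 0 then (if j == 0 then p else q)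
                  else (if j == 0 then r else s)).

Definition traceless_hermitian (R : realType) : {pred 'M[octonion R]_2} :=
  [pred M : 'M[octonion R]_2 |
    (M == \matrix_(i, j) oconj (M j i)) && (\sum_i M i i == 0)].
Arguments traceless_hermitian : clear implicits.

Definition ohopf (R : realType) (u : 'cV[octonion R]_2) : 'M[octonion R]_2 :=
  let x := u 0 0 in
  let y := u 1 0 in
  omx22 (oreal ((onorm x ^+ 2 - onorm y ^+ 2) / 2)) (x *o oconj y)
        (y *o oconj x) (oreal ((onorm y ^+ 2 - onorm x ^+ 2) / 2)).

(* Meant for c in unit_octonion; the formula itself is total in c. *)
Definition oact (R : realType) (u : 'cV[octonion R]_2) (c : octonion R) :
    'cV[octonion R]_2 :=
  let x := u 0 0 in
  let y := u 1 0 in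
  if y != 0 then ovec ((x *o oinv y) *o (y *o c)) (y *o c)
  else ovec (x *o c) 0.

(* A check of the encoding: octonion R is a unital real algebra (bilinear
   product) with multiplicative norm and two-sided inverses, and ohopf takes
   traceless Hermitian values. *)

Lemma osqnorm_ge0 (R : realType) (x : octonion R) : 0 <= osqnorm x.
Proof. by rewrite /osqnorm /cd_sqnorm !addr_ge0 ?sqr_ge0. Qed.

Lemma sqr_onorm (R : realType) (x : octonion R) : onorm x ^+ 2 = osqnorm x.
Proof. by rewrite sqr_sqrtr ?osqnorm_ge0. Qed.

Lemma osqnorm_eq0 (R : realType) (x : octonion R) : (osqnorm x == 0) = (x == 0).
Proof.
rewrite /osqnorm /cd_sqnorm.
case: x => [[[x0 x1] [x2 x3]] [[x4 x5] [x6 x7]]] /=.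
by rewrite !paddr_eq0 ?addr_ge0 ?sqr_ge0 // !sqrf_eq0.
Qed.

Lemma onorm_eq0 (R : realType) (x : octonion R) : (onorm x == 0) = (x == 0).
Proof. by rewrite -sqrf_eq0 sqr_onorm osqnorm_eq0. Qed.

Lemma oscaleE (R : realType) (r x0 x1 x2 x3 x4 x5 x6 x7 : R) :
  r *: ((((x0, x1), (x2, x3)), ((x4, x5), (x6, x7))) : octonion R) =
  (((r * x0, r * x1), (r * x2, r * x3)),
   ((r * x4, r * x5), (r * x6, r * x7))).
Proof. by []. Qed.

Ltac oct_ring :=
  rewrite /oreal /oone /omul /oconj /osqnorm /cd_mul /cd_conj /cd_sqnorm;
  rewrite ?oscaleE /= ?oscaleE;
  congr (((_, _), (_, _)), ((_, _), (_, _))); rewrite /=; ring.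

Ltac oct_case x := case: x => [[[? ?] [? ?]] [[? ?] [? ?]]].

Lemma omul1o (R : realType) (x : octonion R) : oone R *o x = x.
Proof. oct_case x; oct_ring. Qed.

Lemma omulo1 (R : realType) (x : octonion R) : x *o oone R = x.
Proof. oct_case x; oct_ring. Qed.

Lemma omulDl (R : realType) (x y z : octonion R) :
  (x + y) *o z = x *o z + y *o z.
Proof. oct_case x; oct_case y; oct_case z; oct_ring. Qed.

Lemma omulDr (R : realType) (x y z : octonion R) :
  x *o (y + z) = x *o y + x *o z.
Proof. oct_case x; oct_case y; oct_case z; oct_ring. Qed.

Lemma omulZl (R : realType) (r : R) (x y : octonion R) :
  (r *: x) *o y = r *: (x *o y).
Proof. oct_case x; oct_case y; oct_ring. Qed.

Lemma omulZr (R : realType) (r : R) (x y : octonion R) :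
  x *o (r *: y) = r *: (x *o y).
Proof. oct_case x; oct_case y; oct_ring. Qed.

Lemma omul_conjr (R : realType) (x : octonion R) :
  x *o oconj x = oreal (onorm x ^+ 2).
Proof. rewrite sqr_onorm; oct_case x; oct_ring. Qed.

Lemma omul_conjl (R : realType) (x : octonion R) :
  oconj x *o x = oreal (onorm x ^+ 2).
Proof. rewrite sqr_onorm; oct_case x; oct_ring. Qed.

Lemma onormM (R : realType) (x y : octonion R) :
  onorm (x *o y) = onorm x * onorm y.
Proof.
rewrite /onorm -sqrtrM ?osqnorm_ge0 //; congr Num.sqrt.
oct_case x; oct_case y.
rewrite /omul /osqnorm /cd_mul /cd_conj /cd_sqnorm /=; ring.
Qed.

Lemma omulV (R : realType) (x : octonion R) : x != 0 -> x *o oinv x = oone R.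
Proof.
move=> x0; rewrite /oinv omulZr omul_conjr scalerA mulVf ?scale1r //.
by rewrite sqrf_eq0 onorm_eq0.
Qed.

Lemma omulVo (R : realType) (x : octonion R) : x != 0 -> oinv x *o x = oone R.
Proof.
move=> x0; rewrite /oinv omulZl omul_conjl scalerA mulVf ?scale1r //.
by rewrite sqrf_eq0 onorm_eq0.
Qed.

Lemma ohopf_traceless_hermitian (R : realType) (u : 'cV[octonion R]_2) :
  ohopf u \in traceless_hermitian R.
Proof.
rewrite /ohopf; set x := u 0 0; set y := u 1 0.
rewrite inE; apply/andP; split.
  apply/eqP/matrixP => i j; rewrite !mxE.
  case: (altP (i =P 0)) => _; case: (altP (j =P 0)) => _;
    move: x y => x y; oct_case x; oct_case y; oct_ring.
rewrite big_ord_recl big_ord1 !mxE /= -scalerDl -mulrDl.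
by rewrite addrA subrK subrr mul0r scale0r.
Qed.

(* Main.v *)
Require Import Defs.
From mathcomp Require Import all_boot all_order all_algebra.
From mathcomp Require Import reals.
From mathcomp Require Import ring lra.

Set Implicit Arguments.
Unset Strict Implicit.
Unset Printing Implicit Defensive.
Import Order.TTheory GRing.Theory Num.Theory.
Local Open Scope ring_scope.

(* The value of the Hopf map at (x, y) determines |x|^2 - |y|^2 and
   |x||y| = |x y^*|, hence |x| and |y|; so a fibre is given by |x|, |y| and
   x y^*. Alternativity of the octonions, in the form x (x^-1 b) = b and
   (a b^* ) b = |b|^2 a, then shows that c = y^-1 b (or x^-1 a if y = 0) moves
   (x, y) to any other point (a, b) of its fibre. *)

Lemma oconjK (R : realType) : involutive (@oconj R).
Proof. by move=> x; oct_case x; oct_ring. Qed.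

Lemma oconjM (R : realType) (x y : octonion R) :
  oconj (x *o y) = oconj y *o oconj x.
Proof. oct_case x; oct_case y; oct_ring. Qed.

Lemma oconjZ (R : realType) (r : R) (x : octonion R) :
  oconj (r *: x) = r *: oconj x.
Proof. oct_case x; oct_ring. Qed.

Lemma osqnorm_conj (R : realType) (x : octonion R) :
  osqnorm (oconj x) = osqnorm x.
Proof.
oct_case x.
by rewrite /osqnorm /oconj /cd_sqnorm /cd_conj /= !sqrrN.
Qed.

Lemma osqnormM (R : realType) (x y : octonion R) :
  osqnorm (x *o y) = osqnorm x * osqnorm y.
Proof. by rewrite -!sqr_onorm onormM exprMn. Qed.

Lemma unit_octonionE (R : realType) (c : octonion R) :
  (c \in unit_octonion R) = (osqnorm c == 1).
Proof. by rewrite inE -sqr_onorm sqrp_eq1 ?sqrtr_ge0. Qed.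

Lemma omul_conjrK (R : realType) (x y : octonion R) :
  (x *o y) *o oconj y = osqnorm y *: x.
Proof.
(* The coordinates of x *o y are kept as variables until the product with
   oconj y is expanded: unfolding both products at once is very slow. *)
case xyE: (x *o y) => [[[z0 z1] [z2 z3]] [[z4 z5] [z6 z7]]]; move: xyE.
oct_case x; oct_case y; rewrite /omul /cd_mul /cd_conj /=.
case=> e0 e1 e2 e3 e4 e5 e6 e7.
rewrite /oconj /osqnorm /cd_conj /cd_sqnorm oscaleE /=.
by congr (((_, _), (_, _)), ((_, _), (_, _)));
  rewrite /= -?e0 -?e1 -?e2 -?e3 -?e4 -?e5 -?e6 -?e7; ring.
Qed.

Lemma omul_conjKr (R : realType) (x y : octonion R) :
  (x *o oconj y) *o y = osqnorm y *: x.
Proof. by rewrite -{2}[y]oconjK omul_conjrK osqnorm_conj. Qed.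

(** Conjugation is an involution that reverses products, so it carries [omul_conjrK] to this mirror
    image. *)
Lemma omul_conjKl (R : realType) (x y : octonion R) :
  x *o (oconj x *o y) = osqnorm x *: y.
Proof.
apply: (inv_inj (@oconjK R)).
by rewrite !oconjM oconjK omul_conjrK oconjZ.
Qed.

(** Stands in for associativity when solving [x *o c = y] for [c]. *)
Lemma omulVKo (R : realType) (x y : octonion R) :
  x != 0 -> x *o (oinv x *o y) = y.
Proof.
move=> x0; rewrite /oinv sqr_onorm omulZl omulZr omul_conjKl scalerA.
by rewrite mulVf ?scale1r // osqnorm_eq0.
Qed.

Lemma osqnormV (R : realType) (x : octonion R) :
  x != 0 -> osqnorm (oinv x) = (osqnorm x)^-1.
Proof.
move=> x0; have nx : osqnorm x != 0 by rewrite osqnorm_eq0.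
apply: (mulfI nx); rewrite -osqnormM omulV // mulfV //.
by rewrite /osqnorm /oone /cd_sqnorm /= !expr0n /= expr1n !addr0.
Qed.

Lemma oreal_inj (R : realType) : injective (@oreal R).
Proof. by move=> r s []; rewrite /GRing.scale /= !mulr1. Qed.

Lemma ovec_neq0 (R : realType) (x y : octonion R) :
  (ovec x y != 0) = (x != 0) || (y != 0).
Proof.
rewrite -negb_and; congr (~~ _); apply/eqP/andP => [/matrixP e|[/eqP-> /eqP->]].
  by move: (e 0 0) (e 1 0); rewrite !mxE /= => -> ->.
by apply/matrixP => i j; rewrite !mxE if_same.
Qed.

Lemma ovec_inj (R : realType) (x y a b : octonion R) :
  ovec x y = ovec a b -> x = a /\ y = b.
Proof. by move/matrixP => e; move: (e 0 0) (e 1 0); rewrite !mxE. Qed.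

Lemma omx22_inj (R : realType) (p q r s p' q' r' s' : octonion R) :
  omx22 p q r s = omx22 p' q' r' s' -> [/\ p = p', q = q', r = r' & s = s'].
Proof.
by move/matrixP => e; move: (e 0 0) (e 0 1) (e 1 0) (e 1 1); rewrite !mxE.
Qed.

(** The pairs [p], [-q] and [r], [-s] have equal sums and products, so they are the roots of one
    quadratic; the signs decide which roots match. *)
Lemma eq_of_subr_mulr (R : realDomainType) (p q r s : R) :
  0 <= p -> 0 <= q -> 0 <= r -> 0 <= s ->
  p - q = r - s -> p * q = r * s -> p = r.
Proof.
move=> p0 q0 r0 s0 eB eM.
have es : s = r - p + q by lra.
have /eqP : (p - r) * (p + s) = 0.
  by rewrite -[RHS](subrr (p * q)) {2}eM es; ring.
(* If [p + s = 0], nonnegativity gives [p = s = 0], and then [es] forces [r = 0] too. *)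
by rewrite mulf_eq0 => /orP[]/eqP ?; lra.
Qed.

Lemma ohopf_eqP (R : realType) (x y a b : octonion R) :
  ohopf (ovec x y) = ohopf (ovec a b) <->
  [/\ osqnorm x = osqnorm a, osqnorm y = osqnorm b &
      x *o oconj y = a *o oconj b].
Proof.
rewrite /ohopf !mxE /= !sqr_onorm.
split => [/omx22_inj[/oreal_inj eB eM _ _] | [-> -> e]].
  (* The diagonal gives the difference of the squared norms; the norm of the off-diagonal entry
     gives their product. *)
  have := congr1 (@osqnorm R) eM.
  rewrite (osqnormM x) (osqnormM a) (osqnorm_conj y) (osqnorm_conj b) => eN.
  have ex : osqnorm x = osqnorm a.
    by apply: eq_of_subr_mulr eN; rewrite ?osqnorm_ge0 //; lra.
  by split=> //; lra.
(* The lower-left entry is the conjugate of the upper-right one. *)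
by rewrite e -[y *o _]oconjK (oconjM y) oconjK e (oconjM a) oconjK.
Qed.

Theorem lemma17 (R : realType) (x y a b : octonion R)
    (hxy : ovec x y != 0) (hab : ovec a b != 0) :
  ohopf (ovec x y) = ohopf (ovec a b) <->
  exists2 c : octonion R,
    c \in unit_octonion R & ovec a b = oact (ovec x y) c.
Proof.
rewrite ohopf_eqP /oact !mxE /=.
have [y0 | y0] := eqVneq y 0; rewrite /=.
  have o0 (z : octonion R) : z *o oconj (0 : octonion R) = 0.
    by rewrite -(scale0r (0 : octonion R)); oct_case z; oct_ring.
  have x0 : x != 0 by move: hxy; rewrite ovec_neq0 y0 eqxx orbF.
  split=> [[ex ey _] | [c]].
    have b0 : b = 0 by apply/eqP; rewrite -osqnorm_eq0 -ey osqnorm_eq0 y0.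
    (* This [c] has norm 1 because [x] and [a] have equal norms. *)
    exists (oinv x *o a); last by rewrite omulVKo // b0.
    by rewrite unit_octonionE osqnormM osqnormV // ex mulVf // -ex osqnorm_eq0.
  rewrite unit_octonionE => /eqP c1 /ovec_inj[-> ->].
  by rewrite y0 !o0 osqnormM c1 mulr1.
have ny : osqnorm y != 0 by rewrite osqnorm_eq0.
split=> [[ex ey e] | [c]].
  exists (oinv y *o b).
    by rewrite unit_octonionE osqnormM osqnormV // -ey mulVf.
  (* As [oinv y] is a multiple of [oconj y], [e] brings in [(a *o oconj b) *o b], which is
     [osqnorm b *: a]; the scalars cancel by [ey]. *)
  rewrite omulVKo // /oinv sqr_onorm omulZr omulZl e omul_conjKr.
  by rewrite scalerA ey mulVf ?scale1r // -ey.
rewrite unit_octonionE => /eqP c1 /ovec_inj[-> ->].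
(* The factor [y *o c] meets its own conjugate, so [c] enters only through its norm; what remains is
   [osqnorm y *: (x *o oinv y)], that is [x *o oconj y]. *)
rewrite omul_conjrK (osqnormM _ (y *o c)) (osqnormM x) (osqnormM y) osqnormV //.
rewrite c1 !mulr1 mulfVK //; split=> //.
by rewrite /oinv sqr_onorm omulZr scalerA mulfV ?scale1r.
Qed.
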